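(* Let $K$ be a field, $n\ge1$, and let $M$ be a positive commutative binoid that is positively $\mathbb N^n$-graded. Then every $K$-point of $M$ is $\mathbb A^n(K)$-connected with the special point. In particular, if $M$ is also finitely generated, then every cancellative $K$-component of $K\text{-}\mathrm{spec}\,M$ contains the special point.
   Context: A commutative binoid (written additively) is a commutative monoid $(M,+,0)$ with an absorbing element $\infty$ ($a+\infty=\infty$); homomorphisms are monoid homomorphisms with $\infty\mapsto\infty$. $M^\times$ is the unit group, $M_+=M\setminus M^\times$; $M$ is positive if $M^\times=\{0\}$. $M$ is finitely generated if there are finitely many elements such that every element $\neq\infty$ is a finite sum of them. $M$ is $\mathbb N^n$-graded by $\delta=(\delta_1,\ldots,\delta_n):M\setminus\{\infty\}\to\mathbb N^n$ if $\delta(0)=0$ and $\delta(x+y)=\delta(x)+\delta(y)$ whenever $x+y\neq\infty$; the grading is positive if $\delta(a)\neq0$ for all $a\in M_+\setminus\{\infty\}$. For a field $K$, viewed as the binoid $(K,\cdot,1,0)$, a $K$-point of $M$ is a binoid homomorphism $M\to K$, and $K\text{-}\mathrm{spec}\,M$ is the set of all of them. The special point is the $K$-point with $a\mapsto1$ for $a\in M^\times$ and $a\mapsto0$ otherwise. The grading gives an action $\mathbb A^n(K)\times K\text{-}\mathrm{spec}\,M\to K\text{-}\mathrm{spec}\,M$, $(t,\varphi)\mapsto t\varphi$, with $(t\varphi)(a)=t_1^{\delta_1(a)}\cdots t_n^{\delta_n(a)}\varphi(a)$ for $a\neq\infty$ (where $0^0=1$) and $(t\varphi)(\infty)=0$.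 A $K$-point $\varphi$ is $\mathbb A^n(K)$-connected with a $K$-point $\psi$ if $t\varphi=\psi$ for some $t\in\mathbb A^n(K)=K^n$. An ideal of $M$ is a subset $I\ni\infty$ with $I+M\subseteq I$; it is prime if $I\neq M$ and $M\setminus I$ is a submonoid. $M/P$ is obtained from $M$ by identifying all elements of $P$ with $\infty$. For $P$ prime, $(M/P)_{\mathrm{can}}$ is the quotient of $M/P$ by the congruence $a\sim b$ iff $a+s=b+s$ for some $s\in M/P$, $s\ne\infty$. The surjection $M\to(M/P)_{\mathrm{can}}$ identifies $K\text{-}\mathrm{spec}\,(M/P)_{\mathrm{can}}$ with a subset of $K\text{-}\mathrm{spec}\,M$; the maximal ones among these subsets with respect to inclusion ($P$ ranging over all prime ideals) are the cancellative $K$-components. *)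

(* Defs.v *)
From HB Require Import structures.
From mathcomp Require Import all_boot all_order all_algebra.
From mathcomp Require Import boolp classical_sets.

Set Implicit Arguments.
Unset Strict Implicit.
Unset Printing Implicit Defensive.

Import GRing.Theory.
Local Open Scope ring_scope.
Local Open Scope classical_set_scope.
Local Open Scope quotient_scope.

(* 0 = infty is not excluded: the zero binoid is a binoid *)
HB.mixin Record Nmodule_isBinoid M of GRing.Nmodule M := {
  infty : M;
  addr_infty : forall a : M, a + infty = infty
}.

#[short(type="binoidType")]
HB.structure Definition Binoid := {M of GRing.Nmodule M & Nmodule_isBinoid M}.

Arguments infty {s}.

Section Basics.
Variable M : binoidType.

Definition binoid_units : set M := [set a | exists b, a + b = 0].

Definition binoid_plus : set M := ~` binoid_units.

Definition positive_binoid : Prop := binoid_units = [set 0].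

Definition finitely_generated : Prop :=
  exists G : seq M, forall a : M, a <> infty ->
    exists2 l : seq M, {subset l <= G} & a = \sum_(x <- l) x.

(* A degree map M \ {infty} -> N^n is represented by a total function whose
   value at infty is irrelevant. *)
Definition is_grading (n : nat) (delta : M -> 'rV[nat]_n) : Prop :=
  delta 0 = 0 /\
  (forall x y, x + y <> infty -> delta (x + y) = delta x + delta y).

Definition positive_grading (n : nat) (delta : M -> 'rV[nat]_n) : Prop :=
  forall a, binoid_plus a -> a <> infty -> delta a <> 0.

End Basics.

Section KPoints.
Variables (K : fieldType) (M : binoidType).

(* the binoid homomorphisms from M to (K, *, 1, 0) *)
Definition Kspec : set (M -> K) := [set phi |
  [/\ phi 0 = 1, forall a b, phi (a + b) = phi a * phi b & phi infty = 0]].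

Definition special_point : M -> K :=
  fun a => if `[< binoid_units a >] then 1 else 0.

Section Action.
Variables (n : nat) (delta : M -> 'rV[nat]_n).

(* 0 ^+ 0 = 1 holds for exprn *)
Definition affine_act (t : 'rV[K]_n) (phi : M -> K) : M -> K :=
  fun a => if a == infty then 0
           else (\prod_(i < n) t 0 i ^+ delta a 0 i) * phi a.

Definition affine_connected (phi psi : M -> K) : Prop :=
  [/\ Kspec phi, Kspec psi & exists t : 'rV[K]_n, affine_act t phi = psi].

Lemma affine_act_Kspec (t : 'rV[K]_n) (phi : M -> K) :
  is_grading delta -> Kspec phi -> Kspec (affine_act t phi).
Proof.
move=> [d0 dD] [p0 pD pinf]; split; rewrite /affine_act.
- case: eqP => [h|_]; first by rewrite -p0 h pinf.
  by rewrite d0 p0 mulr1 big1 // => i _; rewrite mxE expr0.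
- move=> a b; case: (eqVneq a infty) => [->|_].
    by rewrite addrC addr_infty eqxx mul0r.
  case: (eqVneq b infty) => [->|_]; first by rewrite addr_infty eqxx mulr0.
  case: eqP => [h|h].
    by rewrite mulrACA -pD h pinf mulr0.
  rewrite dD // pD mulrACA -big_split /=; congr (_ * _).
  by apply: eq_bigr => i _; rewrite mxE exprD.
- by rewrite eqxx.
Qed.

End Action.

Lemma special_point_Kspec : (0 : M) <> infty -> Kspec special_point.
Proof.
move=> nz; split; rewrite /special_point.
- by case: asboolP => // -[]; exists 0; rewrite addr0.
- move=> a b; case: (asboolP (binoid_units a)) => [[a' ha]|ha]; last first.
    case: asboolP; rewrite ?mul0r // => -[c hc]; case: ha.
    by exists (b + c); rewrite addrA.
  case: (asboolP (binoid_units b)) => [[b' hb]|hb]; rewrite ?mulr1 ?mulr0.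
    case: asboolP => // -[]; exists (a' + b').
    by rewrite addrACA ha hb addr0.
  case: asboolP => // -[c hc]; case: hb.
  by exists (a + c); rewrite addrCA addrA.
- by case: asboolP => // -[b]; rewrite addrC addr_infty => /esym.
Qed.

End KPoints.

Arguments Kspec : clear implicits.
Arguments special_point : clear implicits.

Section Quotient.
Variable M : binoidType.

Record congruence := Congruence {
  cong_rel :> M -> M -> Prop;
  cong_refl : forall a, cong_rel a a;
  cong_sym : forall a b, cong_rel a b -> cong_rel b a;
  cong_trans : forall a b c, cong_rel a b -> cong_rel b c -> cong_rel a c;
  congD : forall a b c, cong_rel a b -> cong_rel (a + c) (b + c)
}.

Variable R : congruence.

Definition congb : rel M := fun a b => `[< R a b >].

Fact congb_refl : reflexive congb.
Proof. by move=> a; apply/asboolP/cong_refl. Qed.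

Fact congb_sym : symmetric congb.
Proof. by move=> a b; apply/asboolP/asboolP => /cong_sym. Qed.

Fact congb_trans : transitive congb.
Proof.
by move=> b a c /asboolP ab /asboolP bc; apply/asboolP/(cong_trans ab bc).
Qed.

Canonical congb_equiv := EquivRel congb congb_refl congb_sym congb_trans.

Definition quot_binoid := {eq_quot congb_equiv}.

HB.instance Definition _ := Choice.on quot_binoid.
HB.instance Definition _ := EqQuotient.on quot_binoid.

Definition quot_proj (a : M) : quot_binoid := \pi_quot_binoid a.

Definition quot_add (x y : quot_binoid) : quot_binoid :=
  quot_proj (repr x + repr y).

Lemma quot_projP (a b : M) : quot_proj a = quot_proj b <-> R a b.
Proof.
split; first by move=> /(@eqmodP _ congb_equiv) /asboolP.
by move=> h; apply/(@eqmodP _ congb_equiv)/asboolP.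
Qed.

Lemma quot_reprK (x : quot_binoid) : quot_proj (repr x) = x.
Proof. exact: reprK. Qed.

Lemma quot_addE (a b : M) :
  quot_add (quot_proj a) (quot_proj b) = quot_proj (a + b).
Proof.
apply/quot_projP; apply: (@cong_trans _ _ (a + repr (quot_proj b))).
  by apply: congD; apply/quot_projP; rewrite quot_reprK.
by rewrite ![a + _]addrC; apply: congD; apply/quot_projP; rewrite quot_reprK.
Qed.

Fact quot_addA : associative quot_add.
Proof.
move=> x y z; rewrite -(quot_reprK x) -(quot_reprK y) -(quot_reprK z).
by rewrite !quot_addE addrA.
Qed.

Fact quot_addC : commutative quot_add.
Proof. by move=> x y; rewrite /quot_add addrC. Qed.

Fact quot_add0 : left_id (quot_proj 0) quot_add.
Proof. by move=> x; rewrite -(quot_reprK x) quot_addE add0r. Qed.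

HB.instance Definition _ :=
  GRing.isNmodule.Build quot_binoid quot_addA quot_addC quot_add0.

Fact quot_add_infty (x : quot_binoid) : x + quot_proj infty = quot_proj infty.
Proof. by rewrite -(quot_reprK x) [LHS]quot_addE addr_infty. Qed.

HB.instance Definition _ := Nmodule_isBinoid.Build quot_binoid quot_add_infty.

End Quotient.

Section Ideals.
Variable M : binoidType.

Record ideal := Ideal {
  ideal_set :> M -> Prop;
  ideal_infty : ideal_set infty;
  idealD : forall a b, ideal_set a -> ideal_set (a + b)
}.

Definition prime_ideal (P : ideal) : Prop :=
  [/\ ideal_set P <> setT,
      ~ P 0 & forall a b, ~ P a -> ~ P b -> ~ P (a + b)].

Definition rees_rel (I : ideal) (a b : M) : Prop := a = b \/ I a /\ I b.

Fact rees_refl I a : rees_rel I a a. Proof. by left. Qed.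

Fact rees_sym I a b : rees_rel I a b -> rees_rel I b a.
Proof. by move=> [->|[ha hb]]; [left | right]. Qed.

Fact rees_trans I a b c : rees_rel I a b -> rees_rel I b c -> rees_rel I a c.
Proof. by move=> [->|[ha hb]] // [<-|[hb' hc]]; right. Qed.

Fact rees_D I a b c : rees_rel I a b -> rees_rel I (a + c) (b + c).
Proof. by move=> [->|[ha hb]]; [left | right; split; apply: idealD]. Qed.

Definition rees_cong (I : ideal) : congruence M :=
  Congruence (@rees_refl I) (@rees_sym I) (@rees_trans I) (@rees_D I).

Definition rees_quot (I : ideal) : binoidType := quot_binoid (rees_cong I).

End Ideals.

Section Cancellative.
Variable N : binoidType.

Definition integral_binoid : Prop :=
  (0 : N) <> infty /\
  forall a b : N, a <> infty -> b <> infty -> a + b <> infty.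

Definition can_rel (a b : N) : Prop :=
  exists2 s : N, s <> infty & a + s = b + s.

Hypothesis N_int : integral_binoid.

Fact can_refl a : can_rel a a. Proof. by exists 0; first case: N_int. Qed.

Fact can_sym a b : can_rel a b -> can_rel b a.
Proof. by move=> [s hs e]; exists s. Qed.

Fact can_trans a b c : can_rel a b -> can_rel b c -> can_rel a c.
Proof.
move=> [s hs e] [u hu f]; exists (s + u); first by case: N_int => _; apply.
by rewrite addrA e addrAC f addrAC addrA.
Qed.

Fact can_D a b c : can_rel a b -> can_rel (a + c) (b + c).
Proof. by move=> [s hs e]; exists s; rewrite // addrAC e addrAC. Qed.

Definition can_cong : congruence N :=
  Congruence can_refl can_sym can_trans can_D.

Definition can_quot : binoidType := quot_binoid can_cong.

End Cancellative.

Section Components.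
Variables (K : fieldType) (M : binoidType).

Lemma rees_quot_integral (P : ideal M) :
  prime_ideal P -> integral_binoid (rees_quot P).
Proof.
move=> [_ P0 PD].
have inftyE a : quot_proj (rees_cong P) a = infty <-> P a.
  split; first by move=> /quot_projP [->|[]//]; apply: ideal_infty.
  by move=> Pa; apply/quot_projP; right; split=> //; apply: ideal_infty.
split; first by move=> /inftyE.
move=> x y; rewrite -(quot_reprK x) -(quot_reprK y) => hx hy.
by rewrite [_ + _]quot_addE => /inftyE; apply: PD => /inftyE.
Qed.

Definition prime_can (P : ideal M) (hP : prime_ideal P) : binoidType :=
  can_quot (rees_quot_integral hP).

Definition prime_can_proj (P : ideal M) (hP : prime_ideal P) (a : M) :
    prime_can hP :=
  quot_proj (can_cong (rees_quot_integral hP)) (quot_proj (rees_cong P) a).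

Definition Kspec_prime_can (P : ideal M) (hP : prime_ideal P) : set (M -> K) :=
  [set psi \o prime_can_proj hP | psi in Kspec K (prime_can hP)].

Definition cancellative_component (C : set (M -> K)) : Prop :=
  (exists (P : ideal M) (hP : prime_ideal P), C = Kspec_prime_can hP) /\
  (forall (Q : ideal M) (hQ : prime_ideal Q),
     C `<=` Kspec_prime_can hQ -> C = Kspec_prime_can hQ).

End Components.

(* Main.v *)
Require Import Defs.
From mathcomp Require Import all_boot all_order all_algebra.
From mathcomp Require Import boolp classical_sets.

(** The origin [t = 0] of affine space connects every point with the special
    one: [0 ^ delta a] is [1] when [delta a = 0], that is when [a = 0], and [0]
    otherwise.  For a prime [P], the grading forces the class of [0] in
    [(M/P)_can] to be trivial: [c + u = u] with [u] outside [P] gives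
    [delta c = 0], hence [c = 0].  So a unit of [(M/P)_can] lifts only to [0],
    and the special point of [(M/P)_can] pulls back to that of [M]. *)

Set Implicit Arguments.
Unset Strict Implicit.
Unset Printing Implicit Defensive.

Import GRing.Theory.
Local Open Scope ring_scope.

Section Units.
Variables (K : fieldType) (M : binoidType).

Lemma Kspec_nontrivial (phi : M -> K) : Kspec K M phi -> (0 : M) <> infty.
Proof.
by move=> [p0 _ pinf] h; move: pinf; rewrite -h p0 => /eqP; rewrite oner_eq0.
Qed.

(** The two binoids may differ, so that the special point of a quotient can be compared with that of
    [M]. *)
Lemma special_point_eq (N : binoidType) (a : M) (b : N) :
  (binoid_units a <-> binoid_units b) ->
  special_point K M a = special_point K N b.
Proof. by move=> h; rewrite /special_point (asbool_equiv_eq h). Qed.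

Lemma special_point_positive (hM : positive_binoid M) (a : M) :
  special_point K M a = (a == 0)%:R.
Proof.
rewrite /special_point hM.
by case: asboolP => /= h; case: eqP => // ?; case: h.
Qed.

End Units.

Section PositiveGrading.
Variables (n : nat) (M : binoidType) (hM : positive_binoid M).
Variables (delta : M -> 'rV[nat]_n) (hdelta : is_grading delta).
Hypothesis hpos : positive_grading delta.

Lemma positive_grading_eq0 (a : M) : a <> infty -> delta a = 0 -> a = 0.
Proof.
move=> ai da; apply: contrapT => a0; apply: (hpos _ ai da).
by rewrite /binoid_plus hM.
Qed.

(** [M] need not be cancellative, but its degrees lie in a cancellative monoid. *)
Lemma absorbed_eq0 (c u : M) : u <> infty -> c + u = u -> c = 0.
Proof.
move=> ui cu; apply: positive_grading_eq0.
  by move=> ci; apply: ui; rewrite -cu ci addrC addr_infty.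
have := hdelta.2 c u; rewrite cu => /(_ ui) /rowP du.
apply/rowP=> i; have := du i; rewrite !mxE => /eqP.
by rewrite -[X in X == _]add0n eqn_add2r => /eqP.
Qed.

Lemma affine_act0 (K : fieldType) (phi : M -> K) :
  Kspec K M phi -> affine_act delta 0 phi = special_point K M.
Proof.
move=> hphi; have nz := Kspec_nontrivial hphi; case: hphi => p0 _ _.
apply/funext => a; rewrite special_point_positive // /affine_act.
(* At [infty] the action is 0 by convention; the special point agrees because [0 <> infty]. *)
case: eqP => [->|ai]; first by case: eqP => // h; case: nz.
have [->|a0] := eqVneq a 0.
  by rewrite hdelta.1 p0 mulr1 big1 // => i _; rewrite !mxE expr0.
(* One nonzero coordinate of the degree suffices: its factor is a positive power of 0 and kills the
   product. *)
have /existsP[i di] : [exists i, delta a 0 i != 0%N].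
  apply: contraT; rewrite negb_exists => /forallP h; case/eqP: a0.
  apply: positive_grading_eq0 => //; apply/rowP=> i; rewrite mxE.
  by apply/eqP; rewrite -[_ == _]negbK.
by rewrite (bigD1 i) //= mxE expr0n (negPf di) !mul0r.
Qed.

Lemma prime_can_proj_eq0 (P : ideal M) (hP : prime_ideal P) (c : M) :
  prime_can_proj hP c = prime_can_proj hP 0 -> c = 0.
Proof.
move=> /quot_projP [s]; rewrite -(quot_reprK s); set u := repr s => su.
rewrite ![_ + _]quot_addE add0r => cu.
(* The cancelling element [s] is not [infty] in [M/P], so its lift [u] avoids [P]. This turns the
   equality of [c + u] and [u] modulo [P] into one in [M]. *)
have nPu : ~ P u.
  move=> Pu; apply: su; apply/quot_projP; right.
  by split=> //; apply: ideal_infty.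
apply: (@absorbed_eq0 _ u).
  by move=> ui; apply: nPu; rewrite ui; apply: ideal_infty.
by move: cu => /quot_projP [|[_ /nPu]].
Qed.

Lemma special_point_Kspec_prime_can (K : fieldType) (P : ideal M)
    (hP : prime_ideal P) :
  Kspec_prime_can hP (special_point K M).
Proof.
exists (special_point K (prime_can hP)).
  (* If [0] and [infty] had the same class, then [infty = 0] in [M], which would put [0] in [P]. *)
  apply: special_point_Kspec => /esym /(@prime_can_proj_eq0 P hP infty) h.
  by case: hP => _ + _; apply; rewrite -h; apply: ideal_infty.
apply/funext => a /=; apply: special_point_eq.
have projD b :
    prime_can_proj hP a + prime_can_proj hP b = prime_can_proj hP (a + b).
  by rewrite [LHS]quot_addE [quot_proj _ a + _]quot_addE.
split=> [[y]|[b ab]]; last by exists (prime_can_proj hP b); rewrite projD ab.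
(* The inverse [y] is lifted twice, through the cancellative quotient and then through [M/P]. *)
rewrite -(quot_reprK y) -(quot_reprK (repr y)) projD.
by move=> /prime_can_proj_eq0 ab; exists (repr (repr y)).
Qed.

End PositiveGrading.

Theorem theorem5p2p10 (K : fieldType) (n : nat) (hn : (1 <= n)%N)
    (M : binoidType) (hM : positive_binoid M)
    (delta : M -> 'rV[nat]_n) (hdelta : is_grading delta)
    (hpos : positive_grading delta) :
  (forall phi : M -> K, Kspec K M phi ->
     affine_connected delta phi (special_point K M)) /\
  (finitely_generated M ->
     forall C : set (M -> K), cancellative_component C ->
       C (special_point K M)).
Proof.
split=> [phi hphi|_ C [[P [hP ->]] _]]; last first.
  exact: (special_point_Kspec_prime_can hM hdelta hpos).
split=> //; last by exists 0; apply: affine_act0.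
exact/special_point_Kspec/(Kspec_nontrivial hphi).
Qed.
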